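(* Let $\mathcal{S}\subset\mathbb{R}^n$ be compact convex with $\|x\|\le D$ on $\mathcal{S}$ ($D\ge1$), and let $f_1,\dots,f_T:\mathcal{S}\to\mathbb{R}$ be convex, differentiable, $\alpha$-exp-concave, with $\|\nabla f_t\|\le G$ on $\mathcal{S}$, and $T\ge2$. Let $\eta_i=\frac12\frac{\log T}{T\sqrt{2D}}2^{i-1}$, $N=\lceil\frac12\log_2(\frac{2DT^2}{\log^2T})\rceil+1$ and $\mathcal{H}=\{\gamma_i=1-\eta_i: i=1,\dots,N\}$, ordered so that $\gamma_1\ge\dots\ge\gamma_N$. For each $\gamma\in\mathcal{H}$ run a copy $A^\gamma$ of the Discounted Online Newton Step with discount factor $\gamma$ (with $\theta^\gamma_1\in\mathcal{S}$, $P_0=I$, $P_t=\gamma P_{t-1}+\nabla f_t(\theta_t^\gamma)\nabla f_t(\theta_t^\gamma)^\top$, $\theta^\gamma_{t+1}=\operatorname{argmin}_{z\in\mathcal{S}}(z-y)^\top P_t(z-y)$ with $y=\theta^\gamma_t-\frac1{\eta}P_t^{-1}\nabla f_t(\theta^\gamma_t)$, and step parameter $\eta\le\frac12\min\{\frac1{4GD},\alpha\}$), producing $\theta_t^\gamma$. Set initial weights $w_1^{\gamma_i}=\frac{C}{i(i+1)}$ with $C=1+1/|\mathcal{H}|$, play $\theta_t=\sum_{\gamma\in\mathcal{H}}w_t^\gamma\theta_t^\gamma$, and update $$w_{t+1}^\gamma=\frac{w_t^\gamma\exp(-\lambda f_t(\theta_t^\gamma))}{\sum_{\mu\in\mathcal{H}}w_t^\mu\exp(-\lambda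 f_t(\theta_t^\mu))}$$ with $\lambda=\alpha$. Then for any comparator sequence $z_1,\dots,z_T\in\mathcal{S}$ with $\sum_{t=2}^T\|z_t-z_{t-1}\|\le V$, $$\sum_{t=1}^T\big(f_t(\theta_t)-f_t(z_t)\big)\le O(\max\{\log T,\sqrt{TV}\}).$$
   Context: $\alpha$-exp-concave means $e^{-\alpha f_t}$ is concave on $\mathcal{S}$. $O(\cdot)$ hides constants depending only on $n,\alpha,G,D$ and the step parameter $\eta$. *)

(* Defs.v *)
From HB Require Import structures.
From mathcomp Require Import all_boot all_order all_algebra.
From mathcomp Require Import all_classical all_reals all_analysis.
Set Implicit Arguments. Unset Strict Implicit. Unset Printing Implicit Defensive.
Import Order.TTheory GRing.Theory Num.Theory.
Import numFieldNormedType.Exports.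
Local Open Scope classical_set_scope.
Local Open Scope ring_scope.

Section OnlineDefs.
Variables (R : realType) (n : nat).

Definition dotv (x y : 'rV[R]_n) : R := \sum_(j < n) x ord0 j * y ord0 j.
Definition enorm (x : 'rV[R]_n) : R := Num.sqrt (dotv x x).

Definition convex_on (S : set 'rV[R]_n) (f : 'rV[R]_n -> R) : Prop :=
  forall x y, S x -> S y -> forall l : R, 0 <= l <= 1 ->
    f (l *: x + (1 - l) *: y) <= l * f x + (1 - l) * f y.

Definition concave_on (S : set 'rV[R]_n) (f : 'rV[R]_n -> R) : Prop :=
  forall x y, S x -> S y -> forall l : R, 0 <= l <= 1 ->
    l * f x + (1 - l) * f y <= f (l *: x + (1 - l) *: y).

Definition exp_concave_on (alpha : R) (S : set 'rV[R]_n) (f : 'rV[R]_n -> R) :=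
  concave_on S (fun x => expR (- (alpha * f x))).

Definition grad (f : 'rV[R]_n -> R) (x : 'rV[R]_n) : 'rV[R]_n :=
  \row_(j < n) ('d f x (delta_mx ord0 j : 'rV[R]_n)).

Definition quad (P : 'M[R]_n) (z : 'rV[R]_n) : R := (z *m P *m z^T) ord0 ord0.

Definition is_argmin (S : set 'rV[R]_n) (F : 'rV[R]_n -> R) (z : 'rV[R]_n) :=
  S z /\ forall z', S z' -> F z <= F z'.

End OnlineDefs.

Definition numExperts (R : realType) (D : R) (T : nat) : nat :=
  (`|Num.ceil (ln (2 * D * (T%:R) ^+ 2 / (ln (T%:R)) ^+ 2) / (2 * ln 2))|%N).+1.

(* eta_i (paper index i+1, i : 'I_N) and gamma_i = 1 - eta_i *)
Definition eta_grid (R : realType) (D : R) (T : nat) (i : nat) : R :=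
  2^-1 * (ln (T%:R) / (T%:R * Num.sqrt (2 * D))) * 2 ^+ i.
Definition gamma_grid (R : realType) (D : R) (T : nat) (i : nat) : R :=
  1 - eta_grid D T i.

(* initial weights w_1^{gamma_i} = C / (i (i+1)), C = 1 + 1/|H| (paper index i+1) *)
Definition init_weight (R : realType) (N : nat) (i : nat) : R :=
  (1 + (N%:R)^-1) / ((i.+1)%:R * (i.+2)%:R).

(* exponential weights: wts k is the weight vector w_{k+1} *)
Fixpoint wts (R : realType) (n N : nat) (lam : R) (f : nat -> 'rV[R]_n -> R)
    (th : 'I_N -> nat -> 'rV[R]_n) (k : nat) : 'I_N -> R :=
  match k with
  | 0 => fun i => init_weight R N i
  | k'.+1 => fun i =>
      let w := wts lam f th k' in
      w i * expR (- (lam * f k' .+1 (th i k'.+1))) /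
      \sum_(j < N) w j * expR (- (lam * f k'.+1 (th j k'.+1)))
  end.

(* Main.v *)
(* Put M = max(log T, sqrt(T V)).  By exp-concavity the exponential weights lose at
   most (1/alpha) log(1/w_1) against any single expert.  For the expert with
   discount 1 - e, exp-concavity gives
     f_t(x) - f_t(y) <= g.(x - y) - (eta/2) (g.(x - y))^2,  g = grad f_t(x),
   whose quadratic term absorbs the rank-one part of P_t, so the regret telescopes
   in the P_t-norm up to three errors: the motion of the comparator, O(V/e) because
   |P_t| <= 1 + G^2/e; the determinant potential log det P_T = O(log T); and the
   discounting, n T log(1/(1 - e)) = O(T e) for e <= 1/2.  A grid point e with
   e <= M/T < 2e makes all of them O(M), and its index is small enough for its
   initial weight to cost O(log T).  If M >= T/2, where the grid may have no such
   e < 1/2, the trivial bound 2GDT is O(M). *)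
Require Import Defs.
From HB Require Import structures.
From mathcomp Require Import all_boot all_order all_algebra.
From mathcomp Require Import all_classical all_reals all_analysis.
From mathcomp Require Import perm ring lra.
Import Order.TTheory GRing.Theory Num.Theory.
Import numFieldNormedType.Exports.
Local Open Scope classical_set_scope.
Local Open Scope ring_scope.

Set Implicit Arguments.
Unset Strict Implicit.
Unset Printing Implicit Defensive.

(** * Bilinear forms and determinants *)

Section Euclidean.
Variables (R : realType) (n : nat).
Implicit Types (x y z : 'rV[R]_n) (P A : 'M[R]_n).

Definition bilin P x y : R := (x *m P *m y^T) ord0 ord0.

Lemma bilinDl P x y z : bilin P (x + y) z = bilin P x z + bilin P y z.
Proof. by rewrite /bilin !mulmxDl mxE. Qed.

Lemma bilinDr P x y z : bilin P z (x + y) = bilin P z x + bilin P z y.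
Proof. by rewrite /bilin linearD mulmxDr mxE. Qed.

Lemma bilinZl P (a : R) x y : bilin P (a *: x) y = a * bilin P x y.
Proof. by rewrite /bilin -!scalemxAl mxE. Qed.

Lemma bilinZr P (a : R) x y : bilin P y (a *: x) = a * bilin P y x.
Proof. by rewrite /bilin linearZ -scalemxAr mxE. Qed.

Lemma bilinNl P x y : bilin P (- x) y = - bilin P x y.
Proof. by rewrite -scaleN1r bilinZl mulN1r. Qed.

Lemma bilinNr P x y : bilin P y (- x) = - bilin P y x.
Proof. by rewrite -scaleN1r bilinZr mulN1r. Qed.

Lemma bilin_sym P x y : P^T = P -> bilin P x y = bilin P y x.
Proof.
move=> Psym; have tr11 (B : 'M[R]_1) : B ord0 ord0 = B^T ord0 ord0 by rewrite mxE.
by rewrite /bilin tr11 !trmx_mul trmxK Psym mulmxA.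
Qed.

Lemma dotvE x y : dotv x y = (x *m y^T) ord0 ord0.
Proof. by rewrite mxE; apply: eq_bigr => j _; rewrite mxE. Qed.

Lemma bilin1 x y : bilin 1%:M x y = dotv x y.
Proof. by rewrite /bilin mulmx1 dotvE. Qed.

Lemma quadE P x : quad P x = bilin P x x. Proof. by []. Qed.

Lemma dotvC x y : dotv x y = dotv y x.
Proof. by apply: eq_bigr => j _; rewrite mulrC. Qed.

Lemma dotvNr x y : dotv x (- y) = - dotv x y.
Proof. by rewrite -!bilin1 bilinNr. Qed.

Lemma dotvv_ge0 x : 0 <= dotv x x.
Proof. by apply: sumr_ge0 => j _; rewrite -expr2 sqr_ge0. Qed.

Lemma enorm_ge0 x : 0 <= enorm x. Proof. exact: sqrtr_ge0. Qed.

Lemma sqr_enorm x : enorm x ^+ 2 = dotv x x.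
Proof. by rewrite sqr_sqrtr // dotvv_ge0. Qed.

Lemma enormN x : enorm (- x) = enorm x.
Proof. by rewrite /enorm -!bilin1 bilinNl bilinNr opprK. Qed.

(** Cauchy-Schwarz, from the nonnegativity of |s x - y|^2 at its minimizer s = b / a. *)
Lemma normr_dotv_le x y : `|dotv x y| <= enorm x * enorm y.
Proof.
rewrite -(@ler_pXn2r _ 2) ?nnegrE ?mulr_ge0 ?enorm_ge0 ?normr_ge0 //.
rewrite real_normK ?num_real // exprMn !sqr_enorm.
set a := dotv x x; set b := dotv x y; set c := dotv y y.
have a0 : 0 <= a := dotvv_ge0 x; have c0 : 0 <= c := dotvv_ge0 y.
have key s : 0 <= s ^+ 2 * a - 2 * s * b + c.
  suff -> : s ^+ 2 * a - 2 * s * b + c = dotv (s *: x - y) (s *: x - y).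
    exact: dotvv_ge0.
  rewrite -bilin1 bilinDl !bilinDr !bilinNl !bilinNr !bilinZl !bilinZr !bilin1.
  by rewrite (dotvC y x) -/a -/b -/c; ring.
case: (eqVneq a 0) => [a_eq0|a_neq0]; last first.
  have := key (b / a).
  have -> : (b / a) ^+ 2 * a - 2 * (b / a) * b + c = (a * c - b ^+ 2) / a.
    by field.
  by rewrite pmulr_lge0 ?invr_gt0 ?subr_ge0 // lt_def a_neq0.
case: (eqVneq b 0) => [->|b_neq0]; first by rewrite expr0n mulr_ge0.
(* For [a = 0] the expression is affine in [s], and this [s] makes it -1. *)
have := key ((c + 1) / (2 * b)).
have -> : ((c + 1) / (2 * b)) ^+ 2 * a - 2 * ((c + 1) / (2 * b)) * b + c = -1.
  by rewrite a_eq0; field.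
by lra.
Qed.

Lemma enormD_le x y : enorm (x + y) <= enorm x + enorm y.
Proof.
rewrite -(@ler_pXn2r _ 2) ?nnegrE ?addr_ge0 ?enorm_ge0 //.
rewrite sqr_enorm sqrrD !sqr_enorm -bilin1 bilinDl !bilinDr !bilin1 (dotvC y x).
have := le_trans (ler_norm _) (normr_dotv_le x y).
by lra.
Qed.

Lemma enormB_le x y : enorm (x - y) <= enorm x + enorm y.
Proof. by rewrite -[enorm y]enormN enormD_le. Qed.

Lemma enorm_delta j : enorm (delta_mx ord0 j : 'rV[R]_n) = 1.
Proof.
rewrite /enorm /dotv (bigD1 j) //= big1 ?addr0 => [|k kj].
  by rewrite mxE !eqxx mulr1 sqrtr1.
by rewrite mxE (negbTE kj) andbF mulr0.
Qed.

Lemma bilin_delta P i j :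
  bilin P (delta_mx ord0 i) (delta_mx ord0 j) = P i j.
Proof. by rewrite /bilin -rowE trmx_delta -colE !mxE. Qed.

Lemma bilin_rank1 (g x y : 'rV[R]_n) :
  bilin (g^T *m g) x y = dotv g x * dotv g y.
Proof.
by rewrite /bilin mulmxA -mulmxA mxE big_ord1 -!dotvE (dotvC x g).
Qed.

Lemma bilinDm P A x y : bilin (P + A) x y = bilin P x y + bilin A x y.
Proof. by rewrite /bilin mulmxDr mulmxDl mxE. Qed.

Lemma bilinZm (a : R) P x y : bilin (a *: P) x y = a * bilin P x y.
Proof. by rewrite /bilin -scalemxAr -scalemxAl mxE. Qed.

Lemma det_rank1_update P (u : 'cV[R]_n) (v : 'rV[R]_n) : P \in unitmx ->
  \det (P + u *m v) = \det P * (1 + (v *m invmx P *m u) ord0 ord0).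
Proof.
(* Both factorizations of the block matrix [[P, -u], [v, 1]] below have the same
   determinant. *)
move=> Pu; pose B := block_mx P (- u) v (1%:M : 'M[R]_1).
have e1 : B = block_mx P 0 v 1%:M *m
    block_mx 1%:M (- (invmx P *m u)) 0 (1%:M + v *m invmx P *m u).
  rewrite mulmx_block !mulmx1 !mul0mx !mulmx0 !mul1mx !addr0 mulmxN.
  by rewrite mulKVmx // mulmxN addrCA -mulmxA addNr addr0.
have e2 : B = block_mx (P + u *m v) (- u) 0 1%:M *m block_mx 1%:M 0 v 1%:M.
  by rewrite mulmx_block !mulmx1 !mul0mx !mulmx0 !mul1mx !add0r mulNmx addrK.
have := congr1 determinant e1; rewrite e2 !det_mulmx !det_ublock !det_lblock.
rewrite !det1 !mulr1 !mul1r => ->; congr (_ * _).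
by rewrite det_mx11 !mxE eqxx.
Qed.

(** Each of the n! terms of the Leibniz expansion is at most M^n. Only the logarithm of the
    determinant enters the regret, so n! costs a constant depending on [n]. *)
Lemma det_le_fact P (M : R) : 0 <= M -> (forall i j, `|P i j| <= M) ->
  \det P <= n`!%:R * M ^+ n.
Proof.
move=> M0 PM; rewrite /determinant.
apply: (@le_trans _ _ (\sum_(s : 'S_n) M ^+ n)); last first.
  by rewrite sumr_const mulr_natl (_ : #|_| = n`!) //;
     rewrite -card_Sn; apply: eq_card.
apply: ler_sum => s _; apply: le_trans (ler_norm _) _.
rewrite normrM normr_sign mul1r normr_prod.
rewrite -[X in _ <= _ ^+ X]card_ord -prodr_const.
by apply: ler_prod => i _; rewrite normr_ge0 PM.
Qed.

End Euclidean.

(** * Exp-concave functions *)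

Section ExpConcave.
Variables (R : realType) (n : nat).
Implicit Types (x y v : 'rV[R]_n) (S : set 'rV[R]_n) (f : 'rV[R]_n -> R).

Lemma diff_grad f x v : differentiable f x -> 'd f x v = dotv (grad f x) v.
Proof.
move=> fx; rewrite {1}(row_sum_delta v) linear_sum; apply: eq_bigr => j _.
by rewrite linearZ /= mxE mulrC.
Qed.

Lemma convex_set_comb S x y (s : R) : convex_set S -> S x -> S y ->
  0 <= s <= 1 -> S (s *: x + (1 - s) *: y).
Proof.
move=> cS Sx Sy s01.
have := cS x y (Itv01 (proj1 (andP s01)) (proj2 (andP s01))).
by rewrite !inE => /(_ Sx Sy).
Qed.

(** The tangent inequality of the concave function exp(- a f) at [x], divided by exp(- a f(x)). *)
Lemma exp_concave_tangent (a : R) S f x y : 0 < a -> convex_set S ->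
  exp_concave_on a S f -> S x -> S y -> differentiable f x ->
  expR (a * (f x - f y)) <= 1 + a * dotv (grad f x) (x - y).
Proof.
move=> a0 cS ecf Sx Sy fx.
have -> : dotv (grad f x) (x - y) = - dotv (grad f x) (y - x).
  by rewrite -dotvNr opprB.
rewrite -diff_grad // -deriveE //.
set v := y - x; set E := expR (a * (f x - f y)) - 1.
(* Bounding exp(-a h) by 1 / (1 + a h) before letting s -> 0 replaces the chain
   rule for exp (- a f). *)
pose q (s : R) := s^-1 *: (f (s *: v + x) - f x).
have qcvg : q s @[s --> 0^'+] --> 'D_v f x.
  by apply: cvg_dnbhs_at_right; exact: diff_derivable.
(* This is (1 + s E)(1 + a h) <= 1, where [h] = s q(s) is the increment of [f], with 1 subtracted
   and then divided by [s]. The last term vanishes as s -> 0. *)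
have qle : \forall s \near 0^'+, E + a * q s + s * (a * q s * E) <= 0.
  near=> s.
  have s0 : 0 < s by near: s; exact: nbhs_right_gt.
  have s1 : s <= 1 by near: s; exact: nbhs_right_le.
  have := ecf y x Sy Sx s; rewrite (ltW s0) s1 => /(_ isT).
  have -> : s *: y + (1 - s) *: x = s *: v + x.
    by rewrite /v scalerBr scalerBl scale1r addrCA addrC.
  set h := f (s *: v + x) - f x.
  have qh : s * q s = h by rewrite /q /GRing.scale /= mulVKf // gt_eqF.
  have -> : f (s *: v + x) = f x + h by rewrite /h; ring.
  move=> le1.
  have le2 : 1 + s * E <= expR (- (a * h)).
    rewrite -(@ler_pM2r _ (expR (- (a * f x)))) ?expR_gt0 // -expRD.
    have <- : - (a * (f x + h)) = - (a * h) + - (a * f x) by ring.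
    apply: le_trans le1.
    rewrite /E mulrDl mul1r -mulrA mulrBl -expRD mul1r.
    have -> : a * (f x - f y) + - (a * f x) = - (a * f y) by ring.
    by rewrite le_eqVlt; apply/orP; left; apply/eqP; ring.
  have pos : 0 < 1 + s * E.
    rewrite /E mulrBr mulr1 addrCA; apply: ltr_pwDl; last by rewrite subr_ge0.
    by rewrite mulr_gt0 // expR_gt0.
  have le3 : (1 + s * E) * (1 + a * h) <= 1.
    apply: (@le_trans _ _ ((1 + s * E) * expR (a * h))).
      by rewrite ler_pM2l // expR_ge1Dx.
    rewrite -[X in _ <= X](expRxMexpNx_1 (a * h)) mulrC.
    by rewrite ler_pM2l ?expR_gt0.
  rewrite -(@pmulr_rle0 _ s) //.
  rewrite -qh in le3.
  have -> : s * (E + a * q s + s * (a * q s * E)) =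
     (1 + s * E) * (1 + a * (s * q s)) - 1 by ring.
  by rewrite subr_le0.
have lim : (fun s => E + a * q s + s * (a * q s * E)) @ 0^'+ -->
    E + a * 'D_v f x + 0 * (a * 'D_v f x * E).
  apply: cvgD; first by apply: cvgD; [exact: cvg_cst|apply: cvgMr; exact: qcvg].
  apply: cvgM; first by apply: cvg_at_right_filter; exact: cvg_id.
  by apply: cvgMl; apply: cvgMr; exact: qcvg.
have := limr_le (cvgP _ lim) qle; rewrite (cvg_lim _ lim) //.
by rewrite mul0r addr0 /E => /(_ (at_right_proper_filter _)); lra.
Unshelve. all: by end_near. Qed.

Lemma expR_ge_quadratic (u : R) : `|u| <= 2^-1 ->
  1 + u <= expR (u - u ^+ 2 / 4).
Proof.
rewrite ler_norml => /andP[u1 u2]; set v := u - u ^+ 2 / 4.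
(* The square (1 + v/2)^2 <= exp v is not enough: its third-order term in u is
   negative. *)
have -> : expR v = expR (v / 3) ^+ 3.
  by rewrite -expRM_natl; congr expR; field.
have v3 : 0 <= 1 + v / 3 by have := sqr_ge0 (u - 1); rewrite /v; nra.
apply: (@le_trans _ _ ((1 + v / 3) ^+ 3)); last first.
  by rewrite ler_pXn2r ?nnegrE ?expR_ge0 // expR_ge1Dx.
rewrite -subr_ge0.
have -> : (1 + v / 3) ^+ 3 - (1 + u) =
    u ^+ 2 * (12^-1 - u / 6 + u ^+ 2 / 48 + u * (1 - u / 4) ^+ 3 / 27).
  by rewrite /v; field.
apply: mulr_ge0; first exact: sqr_ge0.
have u20 : 0 <= u ^+ 2 by exact: sqr_ge0.
(* For u >= 0 the part 1/12 - u/6 is already nonnegative; for u < 0 the term - u/6 outweighs the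
   last one, whose cube is at most 2. *)
case: (leP 0 u) => u0.
  have : 0 <= u * (1 - u / 4) ^+ 3.
    by rewrite mulr_ge0 // exprn_ge0 //; lra.
  by lra.
have : (1 - u / 4) ^+ 3 <= 2.
  apply: (@le_trans _ _ ((9 / 8) ^+ 3)); last by lra.
  by rewrite ler_pXn2r ?nnegrE //; lra.
by nra.
Qed.

(** Convexity of exp lowers the rate of the tangent inequality from [a] to [b]; then u = b w
    satisfies |u| <= 1/2, where ln(1 + u) <= u - u^2/4. *)
Lemma exp_concave_quadratic_bound (a b : R) S f x y :
  0 < b -> b <= a -> convex_set S ->
  exp_concave_on a S f -> S x -> S y -> differentiable f x ->
  `|b * dotv (grad f x) (x - y)| <= 2^-1 ->
  f x - f y <= dotv (grad f x) (x - y) - b / 4 * dotv (grad f x) (x - y) ^+ 2.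
Proof.
move=> b0 ba cS ecf Sx Sy fx; set w := dotv _ _ => bw.
have a0 : 0 < a by exact: lt_le_trans ba.
set d := f x - f y.
have tan : expR (a * d) <= 1 + a * w
  by exact: exp_concave_tangent a0 cS ecf Sx Sy fx.
have c0 : 0 <= b / a by rewrite divr_ge0 // ltW.
have c1 : b / a <= 1 by rewrite ler_pdivrMr // mul1r.
have conv : expR (b * d) <= (b / a) * expR (a * d) + (1 - b / a).
  have := convex_expR (Itv01 c0 c1) (a * d) 0.
  rewrite !convRE /= expR0 mulr0 addr0 mulr1 /unstable.onem.
  by rewrite mulrA divfK ?gt_eqF.
have le1 : expR (b * d) <= 1 + b * w.
  apply: le_trans conv _.
  have -> : 1 + b * w = b / a * (1 + a * w) + (1 - b / a).
    by field; rewrite gt_eqF.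
  by rewrite lerD2r ler_wpM2l.
have := le_trans le1 (expR_ge_quadratic bw).
rewrite ler_expR => le2; rewrite -(ler_pM2l b0).
by have -> : b * (w - b / 4 * w ^+ 2) = b * w - (b * w) ^+ 2 / 4 by field.
Qed.

Lemma exp_concave_linear_bound (a : R) S f x y : 0 < a -> convex_set S ->
  exp_concave_on a S f -> S x -> S y -> differentiable f x ->
  f x - f y <= dotv (grad f x) (x - y).
Proof.
move=> a0 cS ecf Sx Sy fx; rewrite -(@ler_pM2l _ a) // -(lerD2l 1).
exact: le_trans (expR_ge1Dx _) (exp_concave_tangent a0 cS ecf Sx Sy fx).
Qed.

End ExpConcave.

(** * Exponential weights *)

Section ExponentialWeights.
Variables (R : realType) (n : nat).
Implicit Types (S : set 'rV[R]_n) (f : nat -> 'rV[R]_n -> R).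

(* Jensen's inequality, with unnormalized weights so that the induction on their
   number goes through directly. *)
Lemma convex_set_sum_weighted S N (w : 'I_N.+1 -> R) (x : 'I_N.+1 -> 'rV[R]_n)
    (h : 'rV[R]_n -> R) :
  convex_set S -> concave_on S h ->
  (forall i, 0 < w i) -> (forall i, S (x i)) ->
  let W := \sum_i w i in
  S (W^-1 *: \sum_i w i *: x i) /\
  \sum_i w i * h (x i) <= W * h (W^-1 *: \sum_i w i *: x i).
Proof.
move=> cS ch; elim: N w x => [|N IH] w x w0 Sx /=.
  rewrite !big_ord1 scalerA mulVf ?scale1r ?gt_eqF //.
pose w' i := w (widen_ord (leqnSn _) i); pose x' i := x (widen_ord (leqnSn _) i).
have [] := IH w' x' (fun i => w0 _) (fun i => Sx _).
set W := \sum_(i < N.+1) w' i; set X := \sum_(i < N.+1) w' i *: x' i => SX leX.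
set wl := w ord_max; set xl := x ord_max.
have -> : \sum_i w i = W + wl by rewrite big_ord_recr.
have -> : \sum_i w i *: x i = X + wl *: xl by rewrite big_ord_recr.
have -> : \sum_i w i * h (x i) = \sum_i w' i * h (x' i) + wl * h xl.
  by rewrite big_ord_recr.
have W0 : 0 < W.
  rewrite /W big_ord_recl ltr_pwDl ?w0 // sumr_ge0 // => i _.
  by rewrite ltW // w0.
have wl0 : 0 < wl by exact: w0.
have Wl0 : 0 < W + wl by rewrite addr_gt0.
have r01 : 0 <= W / (W + wl) <= 1.
  rewrite divr_ge0 ?(ltW W0) ?(ltW Wl0) //= ler_pdivrMr // mul1r.
  by rewrite lerDl (ltW wl0).
have r1 : 1 - W / (W + wl) = wl / (W + wl) by field; rewrite gt_eqF.
have -> : (W + wl)^-1 *: (X + wl *: xl) =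
    (W / (W + wl)) *: (W^-1 *: X) + (1 - W / (W + wl)) *: xl.
  rewrite r1 scalerDr !scalerA; congr (_ *: _ + _ *: _); last by rewrite mulrC.
  by rewrite mulrAC mulfV ?gt_eqF // mul1r.
split; first by apply: convex_set_comb => //; exact: Sx.
have := ch _ _ SX (Sx ord_max) _ r01; rewrite -/xl => lec.
apply: le_trans (ler_wpM2l (ltW Wl0) lec).
rewrite r1 mulrDr !mulrA.
rewrite [(W + wl) * W]mulrC [(W + wl) * wl]mulrC.
rewrite !mulfK ?gt_eqF //.
by rewrite lerD2r.
Qed.

Lemma init_weight_gt0 N (i : 'I_N) : 0 < init_weight R N i.
Proof.
by rewrite /init_weight divr_gt0 ?mulr_gt0 ?ltr0n // ltr_pwDl // invr_ge0 ler0n.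
Qed.

(** The sum of 1/((i+1)(i+2)) telescopes to 1 - 1/(N+2), which the factor 1 + 1/(N+1) normalizes
    exactly. *)
Lemma sum_init_weight N : \sum_(i < N.+1) init_weight R N.+1 i = 1.
Proof.
have part k : \sum_(i < k) ((i.+1)%:R * (i.+2)%:R)^-1 = 1 - (k.+1)%:R^-1 :> R.
  elim: k => [|k IH]; first by rewrite big_ord0 invr1 subrr.
  rewrite big_ord_recr /= IH; field.
  by rewrite ?nat1r -?natrD !pnatr_eq0.
rewrite -mulr_sumr part; field.
by rewrite ?nat1r -?natrD !pnatr_eq0.
Qed.

Lemma sum_mul_expR_gt0 N (v u : 'I_N.+1 -> R) : (forall i, 0 < v i) ->
  0 < \sum_i v i * expR (u i).
Proof.
move=> v0; rewrite big_ord_recl; apply: ltr_pwDl.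
  by rewrite mulr_gt0 ?expR_gt0.
by apply: sumr_ge0 => i _; rewrite mulr_ge0 ?expR_ge0 // (ltW (v0 _)).
Qed.

Section Weights.
Variables (N : nat) (lam : R) (f : nat -> 'rV[R]_n -> R).
Variable (th : 'I_N.+1 -> nat -> 'rV[R]_n).
Let w := wts lam f th.

Lemma wts_gt0 k i : 0 < w k i.
Proof.
elim: k i => [|k IH] i /=; first exact: init_weight_gt0.
by rewrite divr_gt0 ?sum_mul_expR_gt0 // mulr_gt0 ?expR_gt0.
Qed.

Lemma sum_wts k : \sum_i w k i = 1.
Proof.
case: k => [|k] /=; first exact: sum_init_weight.
rewrite -mulr_suml mulfV // gt_eqF // sum_mul_expR_gt0 // => i.
exact: wts_gt0.
Qed.

Lemma wts_le1 k i : w k i <= 1.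
Proof.
rewrite -(sum_wts k) (bigD1 i) //= lerDl sumr_ge0 // => j _.
by rewrite ltW // wts_gt0.
Qed.

Variables (S : set 'rV[R]_n) (T : nat).
Hypotheses (lam0 : 0 < lam) (cS : convex_set S).
Hypothesis thS : forall i t, (1 <= t <= T)%N -> S (th i t).
Hypothesis ecf : forall t, (1 <= t <= T)%N -> exp_concave_on lam S (f t).

Lemma weighted_mean_in t : (1 <= t <= T)%N ->
  S (\sum_i w t.-1 i *: th i t).
Proof.
move=> tT; have [] := convex_set_sum_weighted cS (ecf tT) (wts_gt0 t.-1)
  (fun i => thS i tT).
by rewrite sum_wts invr1 scale1r.
Qed.

(** The weight of expert [i] serves as the potential. By exp-concavity the normalizer [Z] is at most
    exp(- lam f(m)), [m] being the point played, so each round multiplies the weight by at least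
    exp(lam times the regret of that round against [i]). *)
Lemma wts_growth k i : (k <= T)%N ->
  w 0 i * expR (lam * \sum_(1 <= t < k.+1)
     (f t (\sum_j w t.-1 j *: th j t) - f t (th i t))) <= w k i.
Proof.
elim: k => [|k IH] kT; first by rewrite big_nil mulr0 expR0 mulr1.
rewrite big_nat_recr //= mulrDr expRD mulrA.
set m := \sum_j w k j *: th j k.+1.
have kT' : (1 <= k.+1 <= T)%N by [].
have [_] := convex_set_sum_weighted cS (ecf kT') (wts_gt0 k)
  (fun i => thS i kT').
rewrite sum_wts invr1 scale1r mul1r -/m.
set Z := \sum_j _ => Zle.
have Z0 : 0 < Z by apply: sum_mul_expR_gt0; exact: wts_gt0.
rewrite -/w -/Z ler_pdivlMr //.
set d := lam * (f k.+1 m - f k.+1 (th i k.+1)).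
apply: (@le_trans _ _ (w k i * expR d * Z)).
  by rewrite ler_wpM2r ?(ltW Z0) // ler_wpM2r ?expR_ge0 // IH // ltnW.
rewrite -mulrA ler_wpM2l ?(ltW (wts_gt0 _ _)) //.
apply: le_trans (ler_wpM2l (expR_ge0 _) Zle) _.
by rewrite -expRD ler_expR /d mulrBr addrC addrA addNr add0r.
Qed.

(** A weight never exceeds 1, so its growth is limited by the initial weight; logarithms give the
    bound. *)
Lemma exponential_weights_regret i :
  \sum_(1 <= t < T.+1) (f t (\sum_j w t.-1 j *: th j t) - f t (th i t))
  <= lam^-1 * - ln (init_weight R N.+1 i).
Proof.
set s := \sum_(1 <= t < T.+1) _.
have := le_trans (wts_growth i (leqnn T)) (wts_le1 T i).
rewrite /w /= -/s => le1; have w0 := init_weight_gt0 i.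
rewrite -(ler_pM2l lam0) mulrA mulfV ?gt_eqF // mul1r.
rewrite -ler_expR expRN lnK ?posrE // -(ler_pM2l w0).
by rewrite mulfV ?gt_eqF.
Qed.

End Weights.
End ExponentialWeights.

(** * The discounted online Newton step *)

Section OnlineNewtonStep.
Variables (R : realType) (n : nat).
Implicit Types (x y z g a : 'rV[R]_n) (P A : 'M[R]_n).

(** The iterate before projection, [P] already including the contribution of [g]. *)
Definition newton_point (eta : R) P x g : 'rV[R]_n :=
  x - eta^-1 *: (invmx P *m g^T)^T.

(** Definiteness is carried separately as a positive determinant, which gives invertibility and is
    itself the potential. *)
Definition psd P := P^T = P /\ forall x, 0 <= quad P x.

Lemma quadD P x y : P^T = P ->
  quad P (x + y) = quad P x + 2 * bilin P x y + quad P y.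
Proof.
by move=> Ps; rewrite !quadE bilinDl !bilinDr (bilin_sym y x Ps); ring.
Qed.

Lemma quadZ P (c : R) x : quad P (c *: x) = c ^+ 2 * quad P x.
Proof. by rewrite !quadE bilinZl bilinZr mulrA. Qed.

Lemma quadN P x : quad P (- x) = quad P x.
Proof. by rewrite !quadE bilinNl bilinNr opprK. Qed.

Lemma psd_rank1 A g : psd A -> psd (A + g^T *m g).
Proof.
move=> [As A0]; split=> [|x]; first by rewrite linearD /= As trmx_mul trmxK.
by rewrite quadE bilinDm bilin_rank1 -expr2 addr_ge0 ?sqr_ge0 //; exact: A0.
Qed.

Lemma psdZ (c : R) A : 0 <= c -> psd A -> psd (c *: A).
Proof.
move=> c0 [As A0]; split=> [|x]; first by rewrite linearZ /= As.
by rewrite quadE bilinZm mulr_ge0 //; exact: A0.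
Qed.

Lemma psd_inv_ge0 A g : psd A -> A \in unitmx -> 0 <= quad (invmx A) g.
Proof.
move=> [As A0] Au; have := A0 (g *m invmx A).
by rewrite /quad trmx_mul trmx_inv As !mulmxA mulmxKV.
Qed.

Lemma det_rank1_gt0 A g : psd A -> 0 < \det A -> 0 < \det (A + g^T *m g).
Proof.
move=> Ap dA; have Au : A \in unitmx by rewrite unitmxE unitfE gt_eqF.
rewrite det_rank1_update // mulr_gt0 // ltr_pwDl //.
exact: psd_inv_ge0.
Qed.

Lemma quad_inv_le_ln_det A g : psd A -> 0 < \det A ->
  quad (invmx (A + g^T *m g)) g <= ln (\det (A + g^T *m g)) - ln (\det A).
Proof.
move=> Ap dA; have dP := det_rank1_gt0 g Ap dA.
set P := A + g^T *m g in dP *.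
have Pu : P \in unitmx by rewrite unitmxE unitfE gt_eqF.
(* det A / det P = 1 - g P^-1 g^T, and q <= - ln (1 - q). *)
have := det_rank1_update (- g^T) g Pu.
rewrite mulNmx /P addrK -/P => e.
have -> : ln (\det A) =
    ln (\det P) + ln (1 + (g *m invmx P *m - g^T) ord0 ord0).
  rewrite -lnM ?posrE // -?e //.
  by move: dA; rewrite e pmulr_rgt0.
rewrite opprD addrA subrr add0r lerNr.
have pos : 0 < 1 + (g *m invmx P *m - g^T) ord0 ord0.
  by move: dA; rewrite e pmulr_rgt0.
rewrite (le_trans (le_ln1Dx _)) //; first by move: pos; lra.
by rewrite mulmxN mxE.
Qed.

(** Expanding the square in the [P']-norm, the cross term cancels the linear loss, and the rank-one
    part of [P'] cancels the quadratic term. *)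
Lemma newton_step_identity (eta gam : R) P P' x z g :
  eta != 0 -> P' = gam *: P + g^T *m g -> P'^T = P' -> P' \in unitmx ->
  dotv g (x - z) - eta / 2 * dotv g (x - z) ^+ 2 +
    eta / 2 * quad P' (newton_point eta P' x g - z) =
  eta / 2 * (gam * quad P (x - z)) + (2 * eta)^-1 * quad (invmx P') g.
Proof.
move=> eta0 defP Ps Pu; set a := x - z; set b := g *m invmx P'.
have -> : newton_point eta P' x g - z = a - eta^-1 *: b.
  by rewrite /newton_point trmx_mul trmxK trmx_inv Ps addrAC.
have ab : bilin P' a b = dotv g a.
  rewrite bilin_sym //.
  by rewrite /bilin /b mulmxKV // -dotvE.
have bb : quad P' b = quad (invmx P') g.
  by rewrite /quad /b mulmxKV // trmx_mul trmx_inv Ps mulmxA.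
have aa : quad P' a = gam * quad P a + dotv g a ^+ 2.
  by rewrite defP quadE bilinDm bilinZm bilin_rank1 expr2.
rewrite quadD // quadN quadZ bilinNr bilinZr ab aa bb.
by field.
Qed.

(** Projection in the [P]-seminorm brings a point no farther from [S]-points: optimality along the
    segment from [x] to [z] makes the cross term [b] nonnegative. *)
Lemma argmin_quad_contract S P p x z : convex_set S -> psd P ->
  is_argmin S (fun y => quad P (y - p)) x -> S z ->
  quad P (x - z) <= quad P (p - z).
Proof.
move=> cS [Ps P0] [Sx xmin] Sz.
set b := bilin P (x - p) (z - x); set c := quad P (z - x).
have c0 : 0 <= c by exact: P0.
have key s : 0 <= s <= 1 -> 0 <= s * (2 * b + s * c).
  move=> s01; have := xmin _ (convex_set_comb cS Sz Sx s01).
  have -> : s *: z + (1 - s) *: x - p = (x - p) + s *: (z - x).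
    by apply/rowP => j; rewrite !mxE; ring.
  by rewrite (quadD (x - p)) // quadZ bilinZr -/b -/c; lra.
have b0 : 0 <= b.
  rewrite leNgt; apply/negP => b_lt0.
  (* The denominator stays positive even if [c = 0]. Here 0 < s <= 1 and 2 b + s c = (1 + s) b < 0,
     a contradiction. *)
  pose s := - b / (c - b).
  have cb : 0 < c - b by lra.
  have s0 : 0 < s by rewrite divr_gt0 ?oppr_gt0.
  have s1 : s <= 1 by rewrite ler_pdivrMr // mul1r; lra.
  have := key s; rewrite (ltW s0) s1 => /(_ isT).
  rewrite pmulr_rge0 //.
  have scb : s * (c - b) = - b by rewrite /s divfK ?gt_eqF.
  have : s * b <= 0 by rewrite mulr_ge0_le0 ?(ltW s0) ?(ltW b_lt0).
  by rewrite mulrBr in scb; lra.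
have -> : p - z = - ((x - p) + (z - x)) by apply/rowP => j; rewrite !mxE; ring.
have -> : x - z = - (z - x) by rewrite opprB.
rewrite !quadN (quadD (x - p)) // -/b.
by have := P0 (x - p); lra.
Qed.

(** * Regret of one expert with discount factor 1 - e *)

Section Discounted.
Variables (S : set 'rV[R]_n) (D G eta e : R) (T : nat).
Variables (g th z : nat -> 'rV[R]_n) (P : nat -> 'M[R]_n).
Hypotheses (D0 : 0 <= D) (eta0 : 0 < eta) (e0 : 0 < e) (e1 : e < 1).
Hypotheses (cS : convex_set S) (SD : forall x, S x -> enorm x <= D).
Hypothesis gG : forall t, (1 <= t <= T)%N -> enorm (g t) <= G.
Hypothesis thS : forall t, (1 <= t <= T)%N -> S (th t).
Hypothesis zS : forall t, (1 <= t <= T)%N -> S (z t).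
Hypothesis P_0 : P 0%N = 1%:M.
Hypothesis P_rec : forall t, (1 <= t <= T)%N ->
  P t = (1 - e) *: P t.-1 + (g t)^T *m g t.
Hypothesis th_next : forall t, (1 <= t < T)%N ->
  is_argmin S (fun y => quad (P t) (y - newton_point eta (P t) (th t) (g t)))
    (th t.+1).

Lemma dons_psd k : (k <= T)%N -> psd (P k) /\ 0 < \det (P k).
Proof.
have gam0 : 0 < 1 - e by rewrite subr_gt0.
elim: k => [_|k IH kT].
  rewrite P_0 det1; split=> //; split=> [|x]; first by rewrite trmx1.
  by rewrite quadE bilin1 dotvv_ge0.
have [pk dk] := IH (ltnW kT); rewrite (P_rec (t := k.+1)) //=.
have pk' := psdZ (ltW gam0) pk.
split; first exact: psd_rank1.
by apply: det_rank1_gt0 => //; rewrite detZ mulr_gt0 // exprn_gt0.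
Qed.

(** An operator-norm bound in bilinear form: basis vectors yield the entries for the determinant,
    and general vectors the cost of comparator motion. *)
Lemma dons_bilin_le k x y : (k <= T)%N ->
  `|bilin (P k) x y| <= (1 + G ^+ 2 / e) * (enorm x * enorm y).
Proof.
have gam0 : 0 < 1 - e by rewrite subr_gt0.
have M1 : G ^+ 2 / e >= 0 by rewrite divr_ge0 ?sqr_ge0 // ltW.
elim: k => [_|k IH kT].
  rewrite P_0 bilin1; apply: le_trans (normr_dotv_le x y) _.
  by rewrite ler_peMl ?mulr_ge0 ?enorm_ge0 // lerDl.
rewrite (P_rec (t := k.+1)) //= bilinDm bilinZm bilin_rank1.
apply: le_trans (ler_normD _ _) _.
have gk : enorm (g k.+1) <= G by exact: gG.
have dle v : `|dotv (g k.+1) v| <= G * enorm v.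
  by apply: le_trans (normr_dotv_le _ _) _; rewrite ler_wpM2r ?enorm_ge0.
(* 1 + G^2/e is stable under M |-> (1 - e) M + G^2. *)
have -> : (1 + G ^+ 2 / e) * (enorm x * enorm y) =
    (1 - e) * ((1 + G ^+ 2 / e) * (enorm x * enorm y)) +
    (G * enorm x) * (G * enorm y) + e * (enorm x * enorm y).
  by field; rewrite gt_eqF.
rewrite -[X in X <= _]addr0 lerD //; last first.
  by rewrite !mulr_ge0 ?enorm_ge0 // ltW.
rewrite lerD //; last by rewrite normrM ler_pM.
by rewrite normrM (gtr0_norm gam0) ler_wpM2l ?(ltW gam0) // IH // ltnW.
Qed.

Lemma dons_ln_det_le k : (k <= T)%N ->
  ln (\det (P k)) <= ln n`!%:R + n%:R * ln (1 + G ^+ 2 / e).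
Proof.
move=> kT; have [_ dk] := dons_psd kT.
have M0 : 0 < 1 + G ^+ 2 / e by rewrite ltr_pwDl // divr_ge0 ?sqr_ge0 // ltW.
rewrite mulr_natl -lnXn // -lnM ?posrE ?ltr0n ?fact_gt0 ?exprn_gt0 //.
rewrite ler_ln ?posrE ?mulr_gt0 ?ltr0n ?fact_gt0 ?exprn_gt0 //.
apply: det_le_fact => [|i j]; first exact: ltW.
rewrite -bilin_delta; apply: le_trans (dons_bilin_le _ _ kT) _.
by rewrite !enorm_delta !mulr1.
Qed.

Lemma enormB_le2D x y : S x -> S y -> enorm (x - y) <= 2 * D.
Proof.
move=> Sx Sy; apply: le_trans (enormB_le _ _) _.
by have := SD Sx; have := SD Sy; lra.
Qed.

(** A difference of squares: the change is bilinear in y' - y and (x - y) + (x - y'), the latter of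
    norm at most 4 D. *)
Lemma dons_quad_shift k x y y' : (k <= T)%N -> S x -> S y -> S y' ->
  quad (P k) (x - y') <=
  quad (P k) (x - y) + (1 + G ^+ 2 / e) * (4 * D * enorm (y' - y)).
Proof.
move=> kT Sx Sy Sy'; have [[Ps _] _] := dons_psd kT.
have -> : quad (P k) (x - y') =
    quad (P k) (x - y) - bilin (P k) (y' - y) ((x - y) + (x - y')).
  have -> : x - y' = (x - y) - (y' - y).
    by rewrite opprB addrA subrK.
  rewrite !quadE !(bilinDl, bilinDr, bilinNl, bilinNr).
  rewrite (bilin_sym y x Ps) (bilin_sym y' x Ps) (bilin_sym y' y Ps); ring.
rewrite lerD2l; apply: le_trans (ler_norm _) _; rewrite normrN.
apply: le_trans (dons_bilin_le _ _ kT) _.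
have M0 : 0 <= 1 + G ^+ 2 / e by rewrite addr_ge0 // divr_ge0 ?sqr_ge0 // ltW.
rewrite ler_wpM2l // mulrC ler_wpM2r ?enorm_ge0 //.
apply: le_trans (enormD_le _ _) _.
by have := enormB_le2D Sx Sy; have := enormB_le2D Sx Sy'; lra.
Qed.

(** The upper bound that exp-concavity gives for the regret of round [t]. *)
Let r t := dotv (g t) (th t - z t) - eta / 2 * dotv (g t) (th t - z t) ^+ 2.
Let y t := newton_point eta (P t) (th t) (g t).

(** The Newton identity with its inverse-quadratic term bounded by the growth of ln det from (1 - e)
    P_{t-1} to P_t; discounting scales the determinant by (1 - e)^n, whence the last term. *)
Lemma dons_step t : (1 <= t <= T)%N ->
  r t + eta / 2 * quad (P t) (y t - z t) <=
  eta / 2 * quad (P t.-1) (th t - z t) +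
  (2 * eta)^-1 * (ln (\det (P t)) - ln (\det (P t.-1)) - n%:R * ln (1 - e)).
Proof.
move=> tT; have /andP[t1 tT'] := tT.
have gam0 : 0 < 1 - e by rewrite subr_gt0.
have [pk dk] := dons_psd (leq_trans (leq_pred t) tT').
have [[Pts _] dPt] := dons_psd tT'.
have Pu : P t \in unitmx by rewrite unitmxE unitfE gt_eqF.
have defP := P_rec tT.
rewrite (newton_step_identity _ _ _ defP) ?gt_eqF //.
apply: lerD.
  rewrite ler_wpM2l ?divr_ge0 ?(ltW eta0) // ler_piMl ?(proj2 pk) //.
  by rewrite gerBl ltW.
rewrite ler_wpM2l ?invr_ge0 ?mulr_ge0 ?(ltW eta0) //.
have pk' := psdZ (ltW gam0) pk.
have dk' : 0 < \det ((1 - e) *: P t.-1).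
  by rewrite detZ mulr_gt0 // exprn_gt0.
have := quad_inv_le_ln_det (g t) pk' dk'.
rewrite -defP detZ lnM ?posrE ?exprn_gt0 // lnXn // -mulr_natl.
by lra.
Qed.

(** The one-round bounds telescope: between rounds, projection contracts the distance to the old
    comparator, and [dons_quad_shift] pays for passing to the new one. *)
Lemma dons_regret :
  (1 <= T)%N ->
  \sum_(1 <= t < T.+1) r t <=
  eta / 2 * (4 * D ^+ 2 +
     (1 + G ^+ 2 / e) * (4 * D * \sum_(2 <= t < T.+1) enorm (z t - z t.-1))) +
  (2 * eta)^-1 * (ln (\det (P T)) - (T * n)%:R * ln (1 - e)).
Proof.
have eta2 : 0 <= eta / 2 by rewrite divr_ge0 ?(ltW eta0).
(* The invariant keeps the distance at the unprojected point, since the projection rule covers only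
   rounds before [T]. *)
have main k : (k < T)%N -> \sum_(1 <= t < k.+2) r t +
    eta / 2 * quad (P k.+1) (y k.+1 - z k.+1) <=
  eta / 2 * (4 * D ^+ 2 +
     (1 + G ^+ 2 / e) * (4 * D * \sum_(2 <= t < k.+2) enorm (z t - z t.-1))) +
  (2 * eta)^-1 * (ln (\det (P k.+1)) - (k.+1 * n)%:R * ln (1 - e)).
  elim: k => [|k IH] kT.
    rewrite big_nat1 (big_geq (m := 2)) //; have tT : (1 <= 1 <= T)%N by [].
    apply: le_trans (dons_step tT) _.
    rewrite /= mulr0 mulr0 addr0 P_0 det1 ln1 subr0 mul1n lerD2r ler_wpM2l //.
    rewrite quadE bilin1 -sqr_enorm.
    have -> : 4 * D ^+ 2 = (2 * D) ^+ 2 by ring.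
    rewrite ler_pXn2r ?nnegrE ?enorm_ge0 ?mulr_ge0 //.
    by apply: enormB_le2D; [exact: thS tT|exact: zS tT].
  have kT1 : (1 <= k.+1 <= T)%N by rewrite /= ltnW.
  have kT2 : (1 <= k.+2 <= T)%N by [].
  rewrite big_nat_recr //= [X in _ * (_ + _ * (_ * X))]big_nat_recr //=.
  have [pk _] := dons_psd (ltnW kT).
  have proj := argmin_quad_contract cS pk (th_next (t := k.+1) kT) (zS kT1).
  have shift := dons_quad_shift (ltnW kT) (thS kT2) (zS kT1) (zS kT2).
  have step := dons_step kT2.
  have := ler_wpM2l eta2 proj; have := ler_wpM2l eta2 shift.
  have := IH (ltnW kT).
  move: step; rewrite -/(y k.+1) /=.
  have -> : (k.+2 * n)%:R = (k.+1 * n)%:R + n%:R :> R.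
    by rewrite -natrD -mulSnr.
  by lra.
move=> T1; have [k defT] : exists k, T = k.+1 by exists T.-1; rewrite prednK.
rewrite defT; apply: le_trans (main k _); last by rewrite defT.
rewrite lerDl mulr_ge0 //.
by have [[_ pk] _] := dons_psd (leqnn T); rewrite -defT.
Qed.

End Discounted.
End OnlineNewtonStep.

(** * Tuning the discount factor *)

Section Grid.
Variable R : realType.
Implicit Types (D s : R) (T : nat).

Lemma ln2_gt0 : 0 < ln 2 :> R.
Proof. by rewrite ln_gt0 // ltr1n. Qed.

Lemma ln2_le_lnT T : (2 <= T)%N -> ln 2 <= ln T%:R :> R.
Proof.
by move=> T2; rewrite ler_ln ?posrE ?ltr0n ?ler_nat // (leq_trans _ T2).
Qed.

Lemma eta_grid_gt0 D T i : 1 <= D -> (2 <= T)%N -> 0 < eta_grid D T i.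
Proof.
move=> D1 T2; have L0 : 0 < ln T%:R :> R := lt_le_trans ln2_gt0 (ln2_le_lnT T2).
rewrite /eta_grid !mulr_gt0 ?invr_gt0 ?exprn_gt0 ?mulr_gt0 ?sqrtr_gt0 //.
  by rewrite ltr0n (leq_trans _ T2).
by rewrite mulr_gt0 // (lt_le_trans ltr01).
Qed.

Lemma eta_gridS D T i : eta_grid D T i.+1 = 2 * eta_grid D T i.
Proof. by rewrite /eta_grid exprS mulrCA. Qed.

Lemma eta_grid0_le D T : 1 <= D -> (2 <= T)%N ->
  eta_grid D T 0 <= ln T%:R / T%:R.
Proof.
move=> D1 T2; have L0 : 0 < ln T%:R :> R := lt_le_trans ln2_gt0 (ln2_le_lnT T2).
have T0 : 0 < T%:R :> R by rewrite ltr0n (leq_trans _ T2).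
have sD1 : 1 <= Num.sqrt (2 * D).
  by rewrite -[X in X <= _]sqrtr1 ler_sqrt; lra.
have sD0 := lt_le_trans ltr01 sD1.
rewrite /eta_grid expr0 mulr1 ler_pdivlMr //.
have -> : 2^-1 * (ln T%:R / (T%:R * Num.sqrt (2 * D))) * T%:R =
    ln T%:R / (2 * Num.sqrt (2 * D)) by field; rewrite !gt_eqF.
by rewrite ler_pdivrMr ?mulr_gt0 // ler_peMr ?(ltW L0) //; lra.
Qed.

(** The number of experts is chosen so that 2^(N-1) >= sqrt(2 D) T / ln T, proved below in squared
    form. *)
Lemma eta_grid_last D T : 1 <= D -> (2 <= T)%N ->
  2^-1 <= eta_grid D T (numExperts D T).-1.
Proof.
move=> D1 T2; have L0 : 0 < ln T%:R :> R := lt_le_trans ln2_gt0 (ln2_le_lnT T2).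
have T0 : 0 < T%:R :> R by rewrite ltr0n (leq_trans _ T2).
have D0 : 0 < 2 * D by rewrite mulr_gt0 // (lt_le_trans ltr01).
have sD0 : 0 < Num.sqrt (2 * D) by rewrite sqrtr_gt0.
rewrite /eta_grid /numExperts /=.
set L := ln T%:R in L0 *; set A := ln _ / _; set m := `|_|%N.
rewrite -mulrA ler_peMr //.
(* The absolute value can only increase the ceiling. *)
have mA : A <= m%:R.
  apply: le_trans (ceil_ge A) _.
  by rewrite /m natr_absz; have := ler_norm (Num.Def.ceil A); rewrite -(ler_int R).
have pow2 : 2 * D * T%:R ^+ 2 / L ^+ 2 <= (2 ^+ m) ^+ 2.
  have X0 : 0 < 2 * D * T%:R ^+ 2 / L ^+ 2.
    by rewrite divr_gt0 ?exprn_gt0 // mulr_gt0 // exprn_gt0.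
  rewrite -exprM -ler_ln ?posrE ?exprn_gt0 // lnXn //.
  move: mA; rewrite /A ler_pdivrMr; last by rewrite mulr_gt0 // ln2_gt0.
  by rewrite -[X in _ -> _ <= X]mulr_natl natrM -[X in _ -> _ <= X]mulrA.
have : Num.sqrt (2 * D) * T%:R / L <= 2 ^+ m.
  rewrite -(@ler_pXn2r _ 2) ?nnegrE ?exprn_ge0 //; last first.
    by rewrite divr_ge0 ?(ltW L0) // mulr_ge0 // ltW.
  rewrite !exprMn sqr_sqrtr ?(ltW D0) // exprVn; exact: pow2.
rewrite ler_pdivrMr // => le1.
rewrite mulrAC ler_pdivlMr ?mulr_gt0 //.
by rewrite mul1r mulrC [L * _]mulrC.
Qed.

(** The grid doubles from a point at most [s] up to at least 1/2 > s, so it crosses [s] between two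
    consecutive indices. *)
Lemma eta_grid_choice D T s : 1 <= D -> (2 <= T)%N ->
  eta_grid D T 0 <= s -> s < 2^-1 ->
  exists i : 'I_(numExperts D T), eta_grid D T i <= s < 2 * eta_grid D T i.
Proof.
move=> D1 T2 s0 s1.
have step m : s < eta_grid D T m ->
    exists2 i, (i < m)%N & eta_grid D T i <= s < 2 * eta_grid D T i.
  elim: m => [|m IH]; first by rewrite ltNge s0.
  case: (ltP s (eta_grid D T m)) => [lt_m _|le_m lt_m].
    by have [i im Hi] := IH lt_m; exists i => //; exact: ltnW.
  by exists m => //; rewrite le_m -eta_gridS.
have [i im Hi] := step _ (lt_le_trans s1 (eta_grid_last D1 T2)).
by exists (Ordinal (leqW im : (i < numExperts D T)%N)).
Qed.

(* [1 / eta_1 <= 2 c T] for [c = horizon_const D] *)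
Definition horizon_const D : R := Num.sqrt (2 * D) / ln 2.

Lemma horizon_const_ge1 D : 1 <= D -> 1 <= horizon_const D.
Proof.
move=> D1; rewrite /horizon_const ler_pdivlMr ?ln2_gt0 // mul1r.
apply: (@le_trans _ _ 1).
  have -> : 2 = 1 + 1 :> R by [].
  by apply: le_ln1Dx; lra.
by rewrite -[X in X <= _]sqrtr1 ler_sqrt; lra.
Qed.

Lemma inv_eta_grid0_le D T : 1 <= D -> (2 <= T)%N ->
  (eta_grid D T 0)^-1 <= 2 * (horizon_const D * T%:R).
Proof.
move=> D1 T2; have L2 := ln2_le_lnT T2; have l2 := ln2_gt0.
have sD0 : 0 <= Num.sqrt (2 * D) by exact: sqrtr_ge0.
rewrite /eta_grid expr0 mulr1 invfM invrK invf_div ler_wpM2l //.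
rewrite /horizon_const [T%:R * _]mulrC mulrAC ler_wpM2r // ler_wpM2l //.
by rewrite lef_pV2 ?posrE // (lt_le_trans l2).
Qed.

(** As T >= 2, the additive constant is absorbed into a multiple of ln T. *)
Lemma ln_horizon_le D T : 1 <= D -> (2 <= T)%N ->
  ln (horizon_const D * T%:R) <= (1 + ln (horizon_const D) / ln 2) * ln T%:R.
Proof.
move=> D1 T2; have L2 := ln2_le_lnT T2; have l2 := ln2_gt0.
have c1 := horizon_const_ge1 D1.
rewrite lnM ?posrE ?(lt_le_trans ltr01) ?ler1n ?(leq_trans _ T2) //.
rewrite mulrDl mul1r addrC lerD2l -mulrA ler_peMr ?ln_ge0 //.
by rewrite mulrC ler_pdivlMr // mul1r.
Qed.

(** Since 2^i = eta_i / eta_0 is at most c T, with c = [horizon_const D], so is i + 1; hence the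
    inverse weight is at most 2 (c T)^2, polynomial in [T]. *)
Lemma neg_ln_init_weight_le D T (i : 'I_(numExperts D T)) :
  1 <= D -> (2 <= T)%N -> eta_grid D T i <= 2^-1 ->
  - ln (init_weight R (numExperts D T) i) <=
  (1 + 2 * (1 + ln (horizon_const D) / ln 2)) * ln T%:R.
Proof.
move=> D1 T2 ei; have L2 := ln2_le_lnT T2; have l2 := ln2_gt0.
have c1 := horizon_const_ge1 D1.
have T0 : 0 < T%:R :> R by rewrite ltr0n (leq_trans _ T2).
have cT0 : 0 < horizon_const D * T%:R.
  by rewrite mulr_gt0 // (lt_le_trans ltr01).
have e0 := eta_grid_gt0 0 D1 T2.
have p2 : 2 ^+ i <= horizon_const D * T%:R.
  have -> : 2 ^+ i = eta_grid D T i / eta_grid D T 0.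
    rewrite /eta_grid expr0 mulr1 mulrAC mulfV ?mul1r //.
    by rewrite -[X in X != 0]mulr1 gt_eqF.
  apply: (@le_trans _ _ (2^-1 * (eta_grid D T 0)^-1)).
    by rewrite ler_wpM2r // invr_ge0 ltW.
  apply: le_trans (ler_wpM2l _ (inv_eta_grid0_le D1 T2)) _ => //.
  by rewrite mulKf.
have i1 : i.+1%:R <= 2 ^+ i :> R by rewrite -natrX ler_nat ltn_expl.
have i2 : i.+2%:R <= 2 * 2 ^+ i :> R.
  by rewrite -exprS -natrX ler_nat ltn_expl.
rewrite -lnV ?posrE ?init_weight_gt0 //.
apply: (@le_trans _ _ (ln (2 * (horizon_const D * T%:R) ^+ 2))).
  have X0 : 0 < 2 * (horizon_const D * T%:R) ^+ 2.
    by apply: mulr_gt0 => //; exact: exprn_gt0.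
  rewrite ler_ln ?posrE ?invr_gt0 ?init_weight_gt0 //.
  rewrite /init_weight invf_div ler_pdivrMr; last first.
    by rewrite ltr_pwDl // invr_ge0.
  apply: (@le_trans _ _ (2 * (horizon_const D * T%:R) ^+ 2)); last first.
    apply: ler_peMr; first by rewrite mulr_ge0 // exprn_ge0 // ltW.
    by rewrite lerDl invr_ge0.
  rewrite expr2 mulrCA; apply: ler_pM => //; first exact: le_trans p2.
  by apply: le_trans i2 _; rewrite ler_wpM2l.
rewrite lnM ?posrE ?exprn_gt0 // lnXn // -[ln (_ * _) *+ 2]mulr_natl.
rewrite [leRHS]mulrDl mul1r lerD //.
by rewrite -mulrA ler_wpM2l // ln_horizon_le.
Qed.

(** Grid values are at least of order 1/T, so the argument of the logarithm is O(T). *)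
Lemma ln_gain_le D G T e : 1 <= D -> (2 <= T)%N -> eta_grid D T 0 <= e ->
  ln (1 + G ^+ 2 / e) <=
  (ln (1 + 2 * G ^+ 2) / ln 2 + (1 + ln (horizon_const D) / ln 2)) * ln T%:R.
Proof.
move=> D1 T2 e_ge; have L2 := ln2_le_lnT T2; have l2 := ln2_gt0.
have c1 := horizon_const_ge1 D1.
have T1 : 1 <= T%:R :> R by rewrite ler1n (leq_trans _ T2).
have e0 : 0 < e := lt_le_trans (eta_grid_gt0 0 D1 T2) e_ge.
have G2 : 0 <= G ^+ 2 by exact: sqr_ge0.
have cT1 : 1 <= horizon_const D * T%:R by rewrite mulr_ege1.
have eV : e^-1 <= 2 * (horizon_const D * T%:R).
  apply: le_trans (inv_eta_grid0_le D1 T2).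
  by rewrite lef_pV2 ?posrE // eta_grid_gt0.
have g1 : 1 <= 1 + 2 * G ^+ 2 by rewrite lerDl mulr_ge0.
apply: (@le_trans _ _ (ln ((1 + 2 * G ^+ 2) * (horizon_const D * T%:R)))).
  rewrite ler_ln ?posrE.
  - by have := ler_wpM2l G2 eV; lra.
  - by rewrite ltr_pwDl // divr_ge0 // ltW.
  - by rewrite mulr_gt0 ?(lt_le_trans ltr01).
rewrite lnM ?posrE ?(lt_le_trans ltr01) // [leRHS]mulrDl lerD ?ln_horizon_le //.
rewrite -mulrA ler_peMr ?ln_ge0 //.
by rewrite mulrC ler_pdivlMr // mul1r.
Qed.

(** The left side is ln(1 + e/(1 - e)) <= e/(1 - e), and 1 - e >= 1/2. *)
Lemma neg_ln_1B_le (e : R) : e <= 2^-1 -> 0 <= e -> - ln (1 - e) <= 2 * e.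
Proof.
move=> e2 e0; have g0 : 0 < 1 - e by lra.
rewrite -lnV ?posrE //.
have -> : (1 - e)^-1 = 1 + e / (1 - e) by field; rewrite gt_eqF.
apply: le_trans (le_ln1Dx _) _.
  by apply: lt_le_trans (divr_ge0 e0 (ltW g0)); lra.
by rewrite ler_pdivrMr //; nra.
Qed.

End Grid.

(** * Assembly of the dynamic regret bound *)

Unset Implicit Arguments.
Set Strict Implicit.

Theorem theorem3p7 (R : realType) (n : nat) (alpha G D eta : R) :
  0 < alpha -> 0 < G -> 1 <= D -> 0 < eta ->
  eta <= 2^-1 * Num.min (4 * G * D)^-1 alpha ->
  exists K : R,
  forall (T : nat) (S : set 'rV[R]_n) (f : nat -> 'rV[R]_n -> R)
    (th : 'I_(numExperts D T) -> nat -> 'rV[R]_n)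
    (P : 'I_(numExperts D T) -> nat -> 'M[R]_n)
    (z : nat -> 'rV[R]_n) (V : R),
  (2 <= T)%N ->
  compact S -> convex_set S -> (forall x, S x -> enorm x <= D) ->
  (forall t, (1 <= t <= T)%N ->
     [/\ convex_on S (f t),
         (forall x, S x -> differentiable (f t) x),
         (forall x, S x -> enorm (grad (f t) x) <= G) &
         exp_concave_on alpha S (f t)]) ->
  (* the Discounted Online Newton Step copies A^{gamma_i}, gamma_i = 1 - eta_i *)
  (forall i, S (th i 1%N)) ->
  (forall i, P i 0%N = 1%:M) ->
  (forall i t, (1 <= t <= T)%N ->
     P i t = gamma_grid D T i *: P i t.-1
             + (grad (f t) (th i t))^T *m grad (f t) (th i t)) ->
  (forall i t, (1 <= t < T)%N ->
     is_argmin S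
       (fun y => quad (P i t)
          (y - (th i t - eta^-1 *: (invmx (P i t) *m (grad (f t) (th i t))^T)^T)))
       (th i t.+1)) ->
  (* comparator sequence with path length at most V *)
  (forall t, (1 <= t <= T)%N -> S (z t)) ->
  \sum_(2 <= t < T.+1) enorm (z t - z t.-1) <= V ->
  (* regret of the meta-algorithm with lambda = alpha *)
  \sum_(1 <= t < T.+1)
     (f t (\sum_(i < numExperts D T) wts alpha f th t.-1 i *: th i t) - f t (z t))
  <= K * Num.max (ln (T%:R)) (Num.sqrt (T%:R * V)).
Proof.
move=> alpha0 G0 D1 eta0 eta_le.
have D0 : 0 < D := lt_le_trans ltr01 D1.
have l2 := ln2_gt0 R.
have GD0 : 0 < 4 * G * D by rewrite !mulr_gt0.
(* The quadratic bound is applied at rate 2 eta: the first inequality makes this rate admissible,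
   the second keeps 2 eta |w| <= 1/2 because |w| <= 2 G D. *)
have [eta_alpha eta_GD] : 2 * eta <= alpha /\ 2 * eta * (4 * G * D) <= 1.
  have le_min : 2 * eta <= Num.min (4 * G * D)^-1 alpha.
    by move: eta_le; rewrite mulrC ler_pdivlMr // mulrC.
  move: le_min; rewrite le_min => /andP[le1 le2]; split=> //.
  by rewrite -ler_pdivlMr // mul1r.
(* [kap] and [c1] are the factors of ln T from [ln_horizon_le] and [ln_gain_le]; [KM] bounds the
   loss to the best-tuned expert and [KE] that expert's regret. The extra 4 G D covers the trivial
   regime. *)
pose kap := 1 + ln (horizon_const D) / ln 2.
pose c1 := ln (1 + 2 * G ^+ 2) / ln 2 + kap.
pose KM := alpha^-1 * (1 + 2 * kap).
pose KE := eta / 2 * (4 * D ^+ 2 / ln 2 + 8 * D * (1 + G ^+ 2)) +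
  (2 * eta)^-1 * (ln n`!%:R / ln 2 + n%:R * c1 + 2 * n%:R).
exists (4 * G * D + (KM + KE)).
have kap0 : 0 <= kap.
  by rewrite addr_ge0 // divr_ge0 ?(ltW l2) // ln_ge0 // horizon_const_ge1.
have c10 : 0 <= c1.
  rewrite addr_ge0 // divr_ge0 ?(ltW l2) // ln_ge0 // lerDl.
  by rewrite mulr_ge0 // sqr_ge0.
have fact0 : 0 <= ln n`!%:R :> R by rewrite ln_ge0 // ler1n fact_gt0.
have KM0 : 0 <= KM.
  by rewrite mulr_ge0 ?invr_ge0 ?(ltW alpha0) // addr_ge0 // mulr_ge0.
have KE0 : 0 <= KE.
  apply: addr_ge0; apply: mulr_ge0.
  - by rewrite divr_ge0 // ltW.
  - apply: addr_ge0; first by rewrite divr_ge0 ?mulr_ge0 ?sqr_ge0 // ltW.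
    by rewrite !mulr_ge0 ?addr_ge0 ?sqr_ge0 // ltW.
  - by rewrite invr_ge0 mulr_ge0 // ltW.
  - rewrite !addr_ge0 ?mulr_ge0 //; last by rewrite invr_ge0 ltW.
move=> T S f th P z V T2 _ cS SD hf th1 P_0 P_rec th_next zS zV.
have T0 : 0 < T%:R :> R by rewrite ltr0n (leq_trans _ T2).
have L2 := ln2_le_lnT R T2.
set L := ln T%:R; set M := Num.max L _.
have L0 : 0 < L := lt_le_trans l2 L2.
have LM : L <= M by rewrite /M le_max lexx.
have M0 : 0 < M := lt_le_trans L0 LM.
have V0 : 0 <= V.
  by apply: le_trans zV; apply: sumr_ge0 => t _; exact: enorm_ge0.
have TVM : T%:R * V <= M ^+ 2.
  rewrite -[leLHS]sqr_sqrtr ?mulr_ge0 //.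
  by rewrite ler_pXn2r ?nnegrE ?sqrtr_ge0 ?(ltW M0) // /M le_max lexx orbT.
have thS i t : (1 <= t <= T)%N -> S (th i t).
  case: t => [|[|t]] // tT.
  by have [] := th_next i t.+1 tT.
have ecf t : (1 <= t <= T)%N -> exp_concave_on alpha S (f t).
  by move=> /hf[].
have meanS := weighted_mean_in cS thS ecf.
set w := wts alpha f th.
have dist (x y : 'rV[R]_n) : S x -> S y -> enorm (x - y) <= 2 * D.
  move=> Sx Sy; exact (enormB_le2D SD Sx Sy).
have grad_le t (x y : 'rV[R]_n) : (1 <= t <= T)%N -> S x -> S y ->
    `|dotv (grad (f t) x) (x - y)| <= 2 * G * D.
  move=> /hf[_ _ fG _] Sx Sy; apply: le_trans (normr_dotv_le _ _) _.
  rewrite [2 * G]mulrC -mulrA.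
  by apply: ler_pM; rewrite ?enorm_ge0 ?fG ?dist.
set reg := \sum_(1 <= t < T.+1) _.
(* When T <= 2 M, the bound 2 G D per round suffices. *)
rewrite mulrDl; case: (ltP (M / T%:R) 2^-1) => [s_lt|s_ge]; last first.
  apply: (@le_trans _ _ (4 * G * D * M)); last first.
    rewrite lerDl; apply: mulr_ge0; last exact: ltW.
    exact: addr_ge0.
  apply: (@le_trans _ _ (\sum_(1 <= t < T.+1) (2 * G * D))).
    rewrite /reg !big_nat; apply: ler_sum => t tT.
    have [_ fd _ _] := hf t tT.
    apply: le_trans (exp_concave_linear_bound alpha0 cS (ecf t tT) (meanS t tT)
      (zS t tT) (fd _ (meanS t tT))) _.
    apply: le_trans (ler_norm _) _; apply: grad_le => //; first exact: meanS.
    exact: zS.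
  rewrite sumr_const_nat subSS subn0 -[_ *+ T]mulr_natl.
  rewrite ler_pdivlMr // in s_ge.
  have -> : 4 * G * D * M = (2 * M) * (2 * G * D) by ring.
  apply: ler_wpM2r; last by move: s_ge; lra.
  by rewrite !mulr_ge0 // ltW.
have s_ge : eta_grid D T 0 <= M / T%:R.
  apply: le_trans (eta_grid0_le D1 T2) _.
  by rewrite ler_wpM2r // invr_ge0 ltW.
(* This [e] balances the two errors: e <= M/T gives T e <= M, while M/T < 2 e and T V <= M^2 give
   V/e <= 2 M. *)
have [i /andP[]] := eta_grid_choice D1 T2 s_ge s_lt.
set e := eta_grid D T i => e_le lt_e.
have e0 : 0 < e by exact: eta_grid_gt0.
have e2 : e <= 2^-1 by rewrite (le_trans e_le) // ltW.
have e1 : e < 1 by lra.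
have grid0_le : eta_grid D T 0 <= e.
  rewrite /e /eta_grid expr0 mulr1 ler_peMr ?exprn_ege1 ?ler1n //.
  by have := eta_grid_gt0 0 D1 T2; rewrite /eta_grid expr0 mulr1; exact: ltW.
have Te : T%:R * e <= M by rewrite mulrC -ler_pdivlMr.
have Ve : V / e <= 2 * M.
  rewrite ler_pdivrMr // -(ler_pM2l T0); apply: le_trans TVM _.
  move: lt_e; rewrite ltr_pdivrMr // => /ltW lt_e.
  have := ler_wpM2l (ltW M0) lt_e; rewrite expr2.
  by move/le_trans; apply; rewrite le_eqVlt; apply/orP; left; apply/eqP; ring.
pose g t := grad (f t) (th i t).
pose r t := dotv (g t) (th i t - z t) - eta / 2 * dotv (g t) (th i t - z t) ^+ 2.
have meta : \sum_(1 <= t < T.+1)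
    (f t (\sum_j w t.-1 j *: th j t) - f t (th i t)) <= KM * L.
  apply: le_trans (exponential_weights_regret alpha0 cS thS ecf i) _.
  rewrite /KM -[leRHS]mulrA ler_wpM2l ?invr_ge0 ?(ltW alpha0) //.
  exact: neg_ln_init_weight_le.
have expert : \sum_(1 <= t < T.+1) r t <= KE * M.
  have gG t : (1 <= t <= T)%N -> enorm (g t) <= G.
    by move=> tT; have [_ _ fG _] := hf t tT; apply: fG; exact: thS.
  have := dons_regret (ltW D0) eta0 e0 e1 cS SD gG (thS i) zS (P_0 i)
    (P_rec i) (th_next i) (ltnW T2).
  move/le_trans; apply.
  have lndet := dons_ln_det_le e0 e1 gG (P_0 i) (P_rec i) (leqnn T).
  have gain := ln_gain_le G D1 T2 grid0_le.
  have M2 : 1 <= M / ln 2 by rewrite ler_pdivlMr // mul1r (le_trans L2).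
  have eV1 : 1 <= e^-1 by rewrite invf_ge1 // ltW.
  have G2 : 0 <= G ^+ 2 by exact: sqr_ge0.
  rewrite /KE [leRHS]mulrDl; apply: lerD.
    rewrite -[leRHS]mulrA; apply: ler_wpM2l; first by rewrite divr_ge0 // ltW.
    rewrite [leRHS]mulrDl; apply: lerD.
      have -> : 4 * D ^+ 2 / ln 2 * M = 4 * D ^+ 2 * (M / ln 2) by ring.
      by rewrite ler_peMr // mulr_ge0 // sqr_ge0.
    (* As 1 <= 1/e, the whole motion term becomes proportional to V/e. *)
    apply: (@le_trans _ _ ((1 + G ^+ 2) / e * (4 * D * V))).
      apply: ler_pM.
      - by rewrite addr_ge0 // divr_ge0 // ltW.
      - rewrite !mulr_ge0 ?(ltW D0) //.
        by apply: sumr_ge0 => t _; exact: enorm_ge0.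
      - by rewrite mulrDl mul1r lerD2r.
      - by rewrite ler_wpM2l // mulr_ge0 // ltW.
    have -> : (1 + G ^+ 2) / e * (4 * D * V) = 4 * D * (1 + G ^+ 2) * (V / e).
      by ring.
    have -> : 8 * D * (1 + G ^+ 2) * M = 4 * D * (1 + G ^+ 2) * (2 * M) by ring.
    by rewrite ler_wpM2l // !mulr_ge0 ?addr_ge0 ?(ltW D0).
  rewrite -[leRHS]mulrA; apply: ler_wpM2l.
    by rewrite invr_ge0 mulr_ge0 // ltW.
  rewrite [leRHS]mulrDl -/g; apply: lerD.
    apply: le_trans lndet _; rewrite [leRHS]mulrDl; apply: lerD.
      have -> : ln n`!%:R / ln 2 * M = ln n`!%:R * (M / ln 2) by ring.
      by rewrite ler_peMr.
    rewrite -[leRHS]mulrA ler_wpM2l //; apply: le_trans gain _.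
    by rewrite ler_wpM2l.
  (* The discounting error is at most n T (2 e) <= 2 n M. *)
  rewrite -mulrN natrM mulrC mulrA.
  have := neg_ln_1B_le e2 (ltW e0) => lne.
  have -> : 2 * n%:R * M = 2 * M * n%:R by ring.
  rewrite ler_wpM2r // mulrC.
  apply: le_trans (ler_wpM2l (ltW T0) lne) _.
  by move: Te; lra.
(* The loss of expert [i] is inserted between those of the player and the comparator; rate b = 2 eta
   turns b/4 into the eta/2 of [r]. *)
have reg_split : reg <= \sum_(1 <= t < T.+1)
    (f t (\sum_j w t.-1 j *: th j t) - f t (th i t)) + \sum_(1 <= t < T.+1) r t.
  rewrite -big_split /= /reg !big_nat; apply: ler_sum => t tT.
  have [_ fd _ _] := hf t tT.
  rewrite -[leLHS](subrKA (f t (th i t))) lerD2l.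
  have -> : r t = dotv (g t) (th i t - z t) -
      2 * eta / 4 * dotv (g t) (th i t - z t) ^+ 2 by rewrite /r; field.
  apply: (exp_concave_quadratic_bound _ eta_alpha cS (ecf t tT) (thS i t tT)
    (zS t tT) (fd _ (thS i t tT))); first by rewrite mulr_gt0.
  have eta20 : 0 <= 2 * eta by rewrite mulr_ge0 // ltW.
  rewrite normrM (ger0_norm eta20).
  apply: le_trans (ler_wpM2l eta20 (grad_le t _ _ tT (thS i t tT) (zS t tT))) _.
  by move: eta_GD; lra.
apply: le_trans reg_split _.
apply: le_trans (lerD meta expert) _.
have : KM * L <= KM * M by rewrite ler_wpM2l.
have : 0 <= 4 * G * D * M by rewrite mulr_ge0 // ltW.
by rewrite mulrDl; lra.
Qed.
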